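(* Let $p$ be a binary word with $r$ runs, minimum run length $r_{\min}$, and maximum run length $r_{\max}$. Let $w$ be a binary word and let $w'$ be $w$ with all negligible boundary runs with respect to $p$ removed. Let $R'$ and $R'_{\max}$ be the number of runs and the maximum run length of $w'$, respectively. For each $1\le i\le r$, set $$\sigma_{r,R'}(i)=\begin{cases}\mathcal{O}_{\le}(R'/r)+2 & \text{if } i\le \tfrac12\,\mathcal{E}_{\le}\bigl(R'-r\,\mathcal{O}_{\le}(R'/r)\bigr),\\ \mathcal{O}_{\le}(R'/r) & \text{otherwise.}\end{cases}$$ Then $$c_p(w)\le \binom{\left\lfloor\frac{R'-r}{2}\right\rfloor+r}{r}\prod_{i=1}^{r}R'_{\max}\left(\frac{R'_{\max}}{2}\bigl(\sigma_{r,R'}(i)+1\bigr)-r_{\min}+1\right)^{r_{\max}-1},$$ with equality when $p$ and $w$ are alternating.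
   Context: A binary word of length $n$ is a string $w=w_1\cdots w_n\in\{0,1\}^n$. An occurrence of $p=p_1\cdots p_\ell$ in $w=w_1\cdots w_n$ is a choice of indices $1\le i_1<\cdots<i_\ell\le n$ such that $w_{i_1}\cdots w_{i_\ell}=p$; $c_p(w)$ is the number of occurrences of $p$ in $w$. A run of length $L$ in a binary word is a maximal block of $L$ consecutive equal letters. A negligible boundary run (NBR) of $w=w_1\cdots w_n$ with respect to $p=p_1\cdots p_\ell$ is either (i) the run at the beginning of $w$, if $w_1\ne p_1$, or (ii) the run at the end of $w$, if $w_n\ne p_\ell$. A binary word is alternating if all its runs have length $1$. For real $x$, $\mathcal{O}_{\le}(x)$ is the largest odd integer $\le x$ and $\mathcal{E}_{\le}(x)$ is the largest even integer $\le x$.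
   Formalization: The bound is proved as c_p(w) ≤ max(0, B), with B the right-hand side: B can be negative while c_p(w)=0 (p=0000, w=0 gives B=−8), so the literal inequality fails there; p is taken nonempty; the equality case is as stated. *)

(* Defs.v *)
From mathcomp Require Import all_boot all_order all_algebra.
From mathcomp Require Import zify.
Set Implicit Arguments.
Unset Strict Implicit.
Unset Printing Implicit Defensive.
Import Order.TTheory GRing.Theory Num.Theory.

Definition word := seq bool.

(* Occurrences are strictly increasing index tuples, 0-based. *)
Definition occurrences (p w : word) : {set (size p).-tuple 'I_(size w)} :=
  [set t : (size p).-tuple 'I_(size w) |
    sorted ltn [seq val j | j <- t] && ([seq nth false w (val j) | j <- t] == p)].

Definition occ (p w : word) : nat := #|occurrences p w|.

(* The maximal blocks of equal letters, from left to right; runs_neq_nil, runs_flatten,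
   runs_const and runs_maximal below characterize this decomposition. *)
Fixpoint runs (w : word) : seq word :=
  match w with
  | [::] => [::]
  | a :: w1 =>
      match runs w1 with
      | (b :: u) :: rs =>
          if a == b then (a :: b :: u) :: rs else [:: a] :: (b :: u) :: rs
      | _ => [:: [:: a]]
      end
  end.

Definition nruns (w : word) : nat := size (runs w).

(* The value on the empty word is 0. *)
Definition max_run (w : word) : nat := \max_(u <- runs w) size u.

(* The default size w is an upper bound for the length of every run, hence is
   harmless when w is nonempty. *)
Definition min_run (w : word) : nat := \big[minn/size w]_(u <- runs w) size u.

Definition alternating (w : word) : bool := all (fun u => size u == 1) (runs w).

(* The k-th run of w (0-based) is a negligible boundary run with respect to p;
   only meaningful for p nonempty and k < nruns w. *)
Definition is_nbr (p w : word) (k : nat) : bool :=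
  ((k == 0) && (head false w != head false p)) ||
  ((k == (nruns w).-1) && (last false w != last false p)).

Definition remove_nbr (p w : word) : word :=
  flatten [seq nth [::] (runs w) k | k <- iota 0 (nruns w) & ~~ is_nbr p w k].

Local Open Scope ring_scope.

(* largest_odd_leP and largest_even_leP below give the expected properties. *)
Definition largest_odd_le (F : archiRealFieldType) (x : F) : int :=
  2 * Num.floor ((x - 1) / 2) + 1.

Definition largest_even_le (F : archiRealFieldType) (x : F) : int :=
  2 * Num.floor (x / 2).

Definition sigma (r R i : nat) : int :=
  let o := largest_odd_le (R%:R / r%:R : rat) in
  if i%:R <= 2^-1 * (largest_even_le (R%:R - r%:R * o%:~R : rat))%:~R :> rat
  then o + 2 else o.

Lemma runs_neq_nil (w u : word) : u \in runs w -> u != [::].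
Proof.
elim: w u => //= a w IH u; case E: (runs w) IH => [|[|b v] rs] IH.
- by rewrite inE => /eqP->.
- by rewrite inE => /eqP->.
- case: ifP => _; rewrite inE => /orP[/eqP->//|H]; last exact: IH.
  by apply: IH; rewrite inE H orbT.
Qed.

Lemma runs_flatten (w : word) : flatten (runs w) = w.
Proof.
elim: w => //= a w; have := @runs_neq_nil w.
case: (runs w) => [|[|b u] rs] /= H IH; first by rewrite -IH.
  by have := H [::]; rewrite inE eqxx => /(_ isT).
by case: ifP => _ /=; rewrite -IH.
Qed.

Lemma runs_const (w u : word) (a b : bool) :
  u \in runs w -> a \in u -> b \in u -> a = b.
Proof.
elim: w u a b => //= c w IH u a b; case E: (runs w) IH => [|[|d v] rs] IH.
- by rewrite inE => /eqP->; rewrite !inE => /eqP-> /eqP->.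
- by rewrite inE => /eqP->; rewrite !inE => /eqP-> /eqP->.
- case: ifP => [/eqP Ecd|_]; rewrite inE => /orP[/eqP->|H].
  + have Hd x : x \in c :: d :: v -> x = d.
      rewrite inE => /orP[/eqP->//|xv].
      by apply: (IH (d :: v)) => //; rewrite inE eqxx.
    by move=> /Hd-> /Hd->.
  + by apply: IH; rewrite inE H orbT.
  + by rewrite !inE => /eqP-> /eqP->.
  + exact: IH.
Qed.

Lemma runs_maximal (w : word) :
  sorted (fun u v => last false u != head false v) (runs w).
Proof.
elim: w => //= a w; case: (runs w) => [|[|d v] rs] //= IH.
case: ifP => [_|/negbT ne] /=; last by rewrite ne.
by case: rs IH.
Qed.

Lemma largest_odd_leP (F : archiRealFieldType) (x : F) (m : int) :
  (m %% 2)%Z = 1 -> (m <= largest_odd_le x) = (m%:~R <= x).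
Proof.
move=> m1; have -> : m = 2 * (m %/ 2)%Z + 1 by lia.
rewrite lerD2r ler_pM2l // Num.Theory.floor_ge_int ler_pdivlMr ?ltr0n //.
by rewrite rmorphD rmorphM /= lerBrDr mulrC.
Qed.

Lemma largest_odd_le_odd (F : archiRealFieldType) (x : F) :
  (largest_odd_le x %% 2)%Z = 1.
Proof. by rewrite /largest_odd_le; lia. Qed.

Lemma largest_even_leP (F : archiRealFieldType) (x : F) (m : int) :
  (m %% 2)%Z = 0 -> (m <= largest_even_le x) = (m%:~R <= x).
Proof.
move=> m0; have -> : m = 2 * (m %/ 2)%Z by lia.
rewrite ler_pM2l // Num.Theory.floor_ge_int ler_pdivlMr ?ltr0n //.
by rewrite rmorphM /= mulrC.
Qed.

Lemma largest_even_le_even (F : archiRealFieldType) (x : F) :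
  (largest_even_le x %% 2)%Z = 0.
Proof. by rewrite /largest_even_le; lia. Qed.

(* The top of the binomial coefficient of the bound is a natural number, even
   for R < r, so that reading it through the absolute value is harmless. *)
Lemma binomial_top_ge0 (r R : nat) :
  0 <= Num.floor ((R%:R - r%:R) / 2 : rat) + r%:Z.
Proof.
suff : - r%:Z <= Num.floor ((R%:R - r%:R) / 2 : rat) by lia.
rewrite Num.Theory.floor_ge_int ler_pdivlMr // rmorphN /= mulNr.
rewrite -pmulrn mulr_natr mulr2n opprD lerD2r.
by rewrite (@le_trans _ _ 0) ?oppr_le0 ?ler0n.
Qed.

(* Main.v *)
(* Discarding the negligible boundary runs does not change the occurrences, so w may be
   taken to start with the first letter of p. Record for every run of p the run of w
   containing its first letter. The indices of these runs of w increase and alternate in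
   parity, so there are C(floor((R' - r)/2) + r, r) possibilities. If consecutive indices
   differ by 2 e_i + 1, the i-th run of p, of length l_i, chooses its first letter in at
   most M = R'max ways and its other letters among at most M (e_i + 1) - 1 letters, that is
   in at most (M (e_i + 1) - rmin + 1)^(rmax - 1) ways. The sum of the 2 e_i + 1 is at most
   R', and a product of values of an affine function is largest for the most balanced e_i;
   the balanced choice is sigma_i = 2 e_i + 1. *)
Require Import Defs.
From mathcomp Require Import all_boot all_order all_algebra.
From mathcomp Require Import zify ring lra.
Set Implicit Arguments.
Unset Strict Implicit.
Unset Printing Implicit Defensive.
Import Order.TTheory GRing.Theory Num.Theory.

(** * Occurrences as a recursive count *)

Fixpoint count_occ (p w : word) : nat :=
  match p, w with
  | [::], _ => 1
  | _ :: _, [::] => 0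
  | a :: p1, b :: w1 => (a == b) * count_occ p1 w1 + count_occ p w1
  end.

(** Bridge from the cardinality in [occ] to the recursion [count_occ]: an explicit duplicate-free
    list of index sequences. *)
Fixpoint occ_indices (p w : word) : seq (seq nat) :=
  match p, w with
  | [::], _ => [:: [::]]
  | _ :: _, [::] => [::]
  | a :: p1, b :: w1 =>
      (if a == b then [seq 0 :: map S s | s <- occ_indices p1 w1] else [::])
      ++ [seq map S s | s <- occ_indices p w1]
  end.

Lemma size_occ_indices (p w : word) : size (occ_indices p w) = count_occ p w.
Proof.
elim: w p => [|b w IH] [|a p] //=; rewrite size_cat size_map IH.
by case: eqP; rewrite ?size_map ?IH ?mul1n.
Qed.

Lemma map_succ_inj : injective (map S).
Proof. exact: inj_map succn_inj. Qed.

Lemma occ_indices_uniq (p w : word) : uniq (occ_indices p w).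
Proof.
elim: w p => [|b w IH] [|a p] //=.
rewrite cat_uniq (map_inj_uniq map_succ_inj) IH andbT; apply/andP; split.
  by case: eqP => // _; rewrite map_inj_uniq // => s t [/map_succ_inj].
apply/hasPn => s /mapP[t _ ->]; case: eqP => // _; apply/mapP => -[u _].
by case: t.
Qed.

Lemma sorted_map_succ (s : seq nat) : sorted ltn (map S s) = sorted ltn s.
Proof. by rewrite sorted_map; apply: eq_sorted => x y /=; rewrite ltnS. Qed.

Lemma map_succ_pred (s : seq nat) : 0 \notin s -> map S (map predn s) = s.
Proof.
move=> s0; rewrite -map_comp -[RHS]map_id; apply/eq_in_map => -[|x] //.
by rewrite (negPf s0).
Qed.

Lemma mem_occ_indices (p w : word) (s : seq nat) :
  (s \in occ_indices p w) =
  [&& sorted ltn s, all (fun k => k < size w) s & map (nth false w) s == p].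
Proof.
elim: w p s => [|b w IH] [|a p] s /=.
- by case: s => [|[|x] s]; rewrite ?inE //= ?andbF.
- by case: s => [|x s] //=; rewrite ?andbF.
- by rewrite inE; case: s => [|x s] //=; rewrite /= !andbF.
have shift q t : (map S t \in [seq map S u | u <- occ_indices q w]) =
  [&& sorted ltn (map S t), all (fun k => k < (size w).+1) (map S t)
    & map (nth false (b :: w)) (map S t) == q].
  rewrite (mem_map map_succ_inj) IH sorted_map_succ all_map -map_comp.
  by congr [&& _, _ & _].
rewrite mem_cat; have [s0|s0] := boolP (0 \in s); last first.
  rewrite -(map_succ_pred s0) shift orbC; case: (a =P b) => [_|_]; last by rewrite orbF.
  set A := (X in X || _); suff -> : (map S (map predn s) \in
     [seq 0 :: map S u | u <- occ_indices p w]) = false by rewrite orbF.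
  by apply/mapP => -[u _]; case: (s) => // x t [].
have -> : (s \in [seq map S u | u <- occ_indices (a :: p) w]) = false.
  by apply/mapP => -[u _ su]; move: s0; rewrite su => /mapP[].
rewrite orbF; case: s s0 => [|x s] //= s0.
case: x s0 => [|x] s0; last first.
  have -> : path ltn x.+1 s = false.
    apply/negP => /= ps; move: s0; rewrite inE /= => s0.
    have /allP := order_path_min ltn_trans ps; move=> /(_ _ s0).
    by [].
  by case: eqP => // _; apply/mapP => -[].
have -> : ((if a == b then [seq 0 :: map S t | t <- occ_indices p w] else [::])
   = [seq 0 :: map S t | t <- if a == b then occ_indices p w else [::]]).
  by case: eqP.
have [s1|s1] := boolP (0 \in s).
  have -> : path ltn 0 s = false.
    apply/negP => /= ps.
    by have /allP := order_path_min ltn_trans ps => /(_ _ s1).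
  by apply/mapP => -[u _ [us]]; move: s1; rewrite us => /mapP[].
rewrite -(map_succ_pred s1); set t := map predn s.
rewrite (mem_map (f := fun t => 0 :: map S t)); last by move=> x y [/map_succ_inj].
have -> : path ltn 0 (map S t) = sorted ltn t.
  by rewrite -sorted_map_succ; case: (t).
rewrite all_map -map_comp /= eqseq_cons.
rewrite (eq_sym b a).
by case: (a =P b) => _; rewrite ?andbF // IH.
Qed.

Lemma occ_count_occ (p w : word) : occ p w = count_occ p w.
Proof.
rewrite -size_occ_indices /occ cardE.
pose f (t : (size p).-tuple 'I_(size w)) := [seq val j | j <- t].
have f_inj : injective f by move=> t u tu; apply/val_inj/(inj_map val_inj).
rewrite -(size_map f); apply/perm_size/uniq_perm.
- by rewrite map_inj_uniq ?enum_uniq.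
- exact: occ_indices_uniq.
move=> s; rewrite mem_occ_indices; apply/mapP/and3P => [[t]|[ss sb sp]].
  rewrite mem_enum inE => /andP[st tp] ->; split=> //.
    by rewrite /f all_map; apply/allP => j _ /=.
  by rewrite -map_comp.
pose u : seq 'I_(size w) := pmap insub s.
have us : map val u = s.
  rewrite /u (pmap_filter (insubK _)); apply/all_filterP.
  by apply/allP => k ks; rewrite /= isSome_insub; move/allP: sb; apply.
have su : size u == size p by rewrite -(size_map val) us -(eqP sp) size_map.
exists (Tuple su) => //; rewrite mem_enum inE [[seq val j | j <- Tuple su]]us ss /=.
by rewrite -(eqP sp) -us -map_comp.
Qed.

(** * Runs *)

Lemma count_occ_nil (w : word) : count_occ [::] w = 1.
Proof. by case: w. Qed.

Lemma count_occ_cons_le (p w : word) (b : bool) :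
  count_occ p w <= count_occ p (b :: w).
Proof. by case: p => [|a p]; rewrite ?count_occ_nil //= leq_addl. Qed.

Lemma count_occ_nseq_le (p w : word) (b : bool) (m n : nat) :
  m <= n -> count_occ p (nseq m b ++ w) <= count_occ p (nseq n b ++ w).
Proof.
move=> /subnKC <-; elim: (n - m) => [|k IH]; first by rewrite addn0.
by rewrite addnS; apply: leq_trans IH (count_occ_cons_le _ _ _).
Qed.

Lemma count_occ_nseq_neq (p w : word) (a b : bool) (m : nat) :
  b != a -> count_occ (a :: p) (nseq m b ++ w) = count_occ (a :: p) w.
Proof. by move=> ba; elim: m => //= m ->; rewrite eq_sym (negPf ba). Qed.

(** The last letter of the pattern cannot match the appended letter, hence no earlier letter of the
    pattern can either. *)
Lemma count_occ_rcons_neq (p v : word) (a b : bool) :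
  b != a -> count_occ (rcons p a) (rcons v b) = count_occ (rcons p a) v.
Proof.
move=> ba; elim: v p => [|c v IH] [|d p] /=.
- by rewrite eq_sym (negPf ba).
- by case: p => [|e p] /=; rewrite muln0.
- by rewrite (IH [::]); case: (v).
- by rewrite IH -rcons_cons IH.
Qed.

Lemma count_occ_cat_neq (p v : word) (b : bool) (m : nat) :
  p != [::] -> b != last false p -> count_occ p (v ++ nseq m b) = count_occ p v.
Proof.
case/lastP: p => // p a _; rewrite last_rcons => ba.
elim: m => [|m IH]; first by rewrite cats0.
by rewrite -addn1 nseqD catA /= cats1 count_occ_rcons_neq.
Qed.

(** If the first letter falls in the leading run, it has [m] positions, and the other letters lie in
    [w] or among at most [m.-1] letters of that run. *)
Lemma count_occ_split_run (p w : word) (a : bool) (m : nat) :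
  count_occ (a :: p) (nseq m a ++ w)
    <= m * count_occ p (nseq m.-1 a ++ w) + count_occ (a :: p) w.
Proof.
elim: m => [|m IH] /=; first by rewrite mul0n.
rewrite eqxx mul1n mulSn -addnA leq_add2l (leq_trans IH) // leq_add2r.
by rewrite leq_mul2l count_occ_nseq_le ?leq_pred ?orbT.
Qed.

Fixpoint alt_word (a : bool) (ms : seq nat) : word :=
  if ms is m :: ms1 then nseq m a ++ alt_word (~~ a) ms1 else [::].

Lemma alt_word_runs (w : word) :
  alt_word (head false w) (map size (runs w)) = w.
Proof.
elim: w => //= a w; have := runs_flatten w; have := @runs_neq_nil w.
have := @runs_const w.
case: (runs w) => [|[|b u] rs] //= Hc H; first by move=> <-.
  by have := H [::]; rewrite inE eqxx => /(_ isT).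
move=> <- /=; case: eqP => [->|/eqP ab] /=.
  by move=> ->.
move=> IH; have -> : ~~ a = b by case: (a) (b) ab => [] [].
by rewrite IH.
Qed.

Lemma runs_cons (b : bool) (w : word) :
  exists v rs, runs (b :: w) = (b :: v) :: rs.
Proof.
rewrite /=; case: (runs w) => [|[|c x] y]; try by exists [::], [::].
by case: eqP => _; [exists (c :: x), y | exists [::], ((c :: x) :: y)].
Qed.

(** This local form passes to contiguous subwords, which is how alternation survives the removal of
    boundary runs. *)
Lemma alternatingE (w : word) : alternating w = sorted (fun a b => a != b) w.
Proof.
elim: w => // a [|b w] // IH; have [v [rs E]] := runs_cons b w.
rewrite -[LHS]/(all _ (runs (a :: b :: w))) -[runs _]/(match runs (b :: w) with
  | [::] => _ | _ => _ end).
rewrite -[RHS]/((a != b) && sorted (fun a b => a != b) (b :: w)) -IH.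
by rewrite /alternating E; case: eqP.
Qed.

Lemma alternating_map_size (w : word) :
  alternating w -> map size (runs w) = nseq (nruns w) 1.
Proof.
rewrite /nruns /alternating; elim: (runs w) => //= u rs IH /andP[/eqP -> /IH ->].
by [].
Qed.

Lemma alt_word_runs_head (a : bool) (w : word) :
  w = [::] \/ head false w = a -> alt_word a (map size (runs w)) = w.
Proof. by case=> [->//|<-]; exact: alt_word_runs. Qed.

Lemma size_le_max_run (w : word) (u : word) : u \in runs w -> size u <= max_run w.
Proof. by move=> uw; apply: (leq_bigmax_seq (F := size)). Qed.

Lemma run_nseq (w u : word) (a : bool) :
  u \in runs w -> a \in u -> u = nseq (size u) a.
Proof.
move=> uw au; apply/all_pred1P/allP => b bu /=.
by apply/eqP; exact: runs_const uw bu au.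
Qed.

(** The removed letters cannot start, respectively end, an occurrence of [p]. The last clause lets
    [remove_nbr p w] be encoded by [alt_word] from the first letter of [p]. *)
Lemma remove_nbr_cat (p w : word) : exists m n,
  w = nseq m (~~ head false p) ++ remove_nbr p w ++ nseq n (~~ last false p)
  /\ (remove_nbr p w = [::] \/ head false (remove_nbr p w) = head false p).
Proof.
have flw := runs_flatten w; have ne := @runs_neq_nil w.
have runE u a : u \in runs w -> a \in u -> u = nseq (size u) a := @run_nseq w u a.
have negE (a b : bool) : a != b -> a = ~~ b by case: a b => [] [].
rewrite /remove_nbr /nruns /is_nbr /nruns.
case E : (runs w) flw ne runE => [|u rs] flw ne runE.
  by exists 0, 0; rewrite -flw; split; [|left].
have uN : u != [::] by apply: ne; rewrite inE eqxx.
have hu : head false w = head false u by rewrite -flw; case: (u) uN.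
have hu_u : head false u \in u by case: (u) uN => // *; rewrite inE eqxx.
(* A single run is both first and last and may be removed for either reason, so it is treated
   apart. *)
case/lastP: rs E flw ne runE => [|mid v] E flw ne runE.
  have lu : last false w = last false u by rewrite -flw /= cats0.
  have lu_u : last false u \in u by case: (u) uN => //= *; rewrite mem_last.
  have {}runE a : a \in u -> u = nseq (size u) a by apply: runE; rewrite inE.
  move: flw; rewrite /= cats0 => <-.
  have [h|h] := boolP (head false u != head false p); rewrite /=.
    exists (size u), 0; rewrite /= cats0; split; last by left.
    by rewrite -(negE _ _ h) -runE.
  have [l|l] := boolP (last false u != last false p); rewrite /=.
    exists 0, (size u); split; last by left.
    by rewrite /= -(negE _ _ l) -runE.
  exists 0, 0; rewrite /= !cats0; split=> //; right.
  by rewrite (eqP (negbNE h)).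
have vN : v != [::] by apply: ne; rewrite inE mem_rcons inE eqxx orbT.
have lv_v : last false v \in v by case: (v) vN => //= *; rewrite mem_last.
have lv : last false w = last false v.
  by rewrite -flw /= flatten_rcons !last_cat; case: (v) vN.
have uE := runE u _ (mem_head _ _) hu_u.
have vE : v = nseq (size v) (last false v).
  by apply: runE; rewrite // inE mem_rcons inE eqxx orbT.
have -> : size (u :: rcons mid v) = (1 + (size mid + 1))%N by rewrite /= size_rcons addn1.
rewrite !iotaD !filter_cat !map_cat !flatten_cat add0n.
rewrite [[seq k <- iota 1 _ | _]](_ : _ = iota 1 (size mid)); last first.
  apply/all_filterP/allP => k; rewrite mem_iota => /andP[k0 km].
  have /negPf -> : k != 0 by rewrite -lt0n.
  have /negPf -> : k != (1 + (size mid + 1)).-1.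
    by rewrite addnA addn1 /= neq_ltn km.
  by [].
have -> : [seq nth [::] (u :: rcons mid v) k | k <- iota 1 (size mid)] = mid.
  apply: (@eq_from_nth _ [::]); rewrite size_map size_iota // => k km.
  rewrite (nth_map 0) ?size_iota // nth_iota //= nth_rcons km.
  by [].
have flE : w = u ++ flatten mid ++ v by rewrite -flw /= flatten_rcons.
rewrite hu lv flE.
rewrite !add1n !addn1 /= eqxx orbF /=.
have nthv : nth [::] (rcons mid v) (size mid) = v by rewrite nth_rcons ltnn eqxx.
pose u' := if head false u != head false p then [::] else u.
pose v' := if last false v != last false p then [::] else v.
rewrite (_ : flatten [seq _ | k <- if _ then [:: 0] else _] = u'); last first.
  by rewrite /u'; case: (_ != _); rewrite //= cats0.
rewrite (_ : flatten [seq _ | k <- if _ then _ else _] = v'); last first.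
  by rewrite /v'; case: (_ != _); rewrite //= nthv cats0.
exists (size u - size u'), (size v - size v'); split.
  have vE' : v = v' ++ nseq (size v - size v') (~~ last false p).
    rewrite /v'; case: ifP => h; last by rewrite subnn cats0.
    by rewrite subn0 -(negE _ _ h) -vE.
  rewrite {1}vE' {1}(_ : u = nseq (size u - size u') (~~ head false p) ++ u').
    by rewrite -!catA.
  rewrite /u'; case: ifP => h; last by rewrite subnn.
  by rewrite cats0 subn0 -(negE _ _ h) -uE.
(* Adjacent runs carry different letters: once a first run with the wrong letter is dropped, the
   next one has the first letter of [p]. *)
have := runs_maximal w; rewrite E /u' /= => path_u.
case: ifP => [h|/negbFE/eqP <-]; last by right; case: (u) uN.
have lu : last false u = head false u.
  apply: (@runs_const w u); rewrite ?E ?mem_head //.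
  by case: (u) uN => //= *; rewrite mem_last.
have {}h b : last false u != b -> b = head false p.
  by rewrite lu; case: (head _ _) (head _ _) b h => [] [] [].
case: mid path_u ne {E flw runE nthv flE} => [|x mid] /= /andP[/h ux _] ne.
  by rewrite /v'; case: ifP => _; [left|right].
have : x != [::] by apply: ne; rewrite !inE eqxx orbT.
by move=> xN; right; case: (x) xN ux.
Qed.

Lemma count_occ_remove_nbr (p w : word) :
  p != [::] -> count_occ p (remove_nbr p w) = count_occ p w.
Proof.
case: p => // a p _; have [m [n [wE _]]] := remove_nbr_cat (a :: p) w.
rewrite [in RHS]wE /= count_occ_nseq_neq; last by case: (a).
by rewrite count_occ_cat_neq //=; case: (last _ _).
Qed.

Lemma alternating_remove_nbr (p w : word) :
  alternating w -> alternating (remove_nbr p w).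
Proof.
have [m [n [wE _]]] := remove_nbr_cat p w.
rewrite !alternatingE; rewrite {1}wE => /cat_sorted2[_ /cat_sorted2[//]].
Qed.

(** * Summation over the runs containing the first letters *)

(* Sum, over the ways to place the first letters of runs of lengths ls into R runs
   with the first one in the first run, of the product of the weights g l e; here the
   next run of p starts 2 e + 1 runs further. In the base case [R < 2] says that the
   last gap 2 e + 1 reaches the end of the word, up to parity. *)
Fixpoint sum_from_first (g : nat -> nat -> nat) (ls : seq nat) (R : nat) : nat :=
  match ls with
  | [::] => R < 2
  | l :: ls1 =>
      if R is R1.+1 then
        \sum_(0 <= e < R1./2.+1) g l e * sum_from_first g ls1 (R1 - e.*2)
      else 0
  end.

(* As above, but the first run used may be any run of the right letter. *)
Definition sum_from_any (g : nat -> nat -> nat) (ls : seq nat) (R : nat) : nat :=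
  \sum_(0 <= e < R./2.+1) sum_from_first g ls (R - e.*2).

Lemma sum_from_anySS g ls R :
  sum_from_any g ls R.+2 = sum_from_first g ls R.+2 + sum_from_any g ls R.
Proof.
rewrite /sum_from_any /= big_nat_recl //= subn0.
Qed.

Lemma sum_from_any_nil g R : sum_from_any g [::] R = 1.
Proof.
suff: sum_from_any g [::] R = 1 /\ sum_from_any g [::] R.+1 = 1 by case.
elim: R => [|R [IH1 IH2]]; first by rewrite /sum_from_any !big_nat1.
split; first exact: IH2.
by rewrite sum_from_anySS IH1.
Qed.

(* Pascal's rule along the pairs of runs: [(R - r)/2 + r = (R + r)/2]. *)
Lemma sum_from_any1 ls R :
  sum_from_any (fun _ _ => 1) ls R = 'C((R + size ls)./2, size ls).
Proof.
elim: ls R => [|l ls IH] R; first by rewrite sum_from_any_nil bin0.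
have firstE n : sum_from_first (fun _ _ => 1) (l :: ls) n.+1
    = 'C((n + size ls)./2, size ls).
  by rewrite /= -IH; apply: eq_bigr => e _; rewrite mul1n.
(* The recursion moves by two runs, so consecutive values of [R] are treated together. *)
suff: sum_from_any (fun _ _ => 1) (l :: ls) R = 'C((R + (size ls).+1)./2, (size ls).+1) /\
      sum_from_any (fun _ _ => 1) (l :: ls) R.+1 = 'C((R.+1 + (size ls).+1)./2, (size ls).+1).
  by case.
elim: R => [|R [IH1 IH2]].
  rewrite /sum_from_any !big_nat1 firstE /= add0n; split.
    by rewrite bin_small // ltnS uphalf_half; lia.
  case: (size ls) => [|k] //=.
  by rewrite !bin_small // ?uphalf_half; lia.
split=> //; rewrite sum_from_anySS IH1 firstE !addSn !addnS /= binS addnC.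
by congr (_ + _).
Qed.

(** * Bounding occurrences by weighted placements of runs *)

Section RunChoices.
Variable M : nat.

(* The first letter of the run is chosen among M; the others among the M - 1 letters left
   in the same run and those of e further runs of the same letter. *)
Definition run_choices (l e : nat) : nat := M * 'C(M.-1 + e * M, l.-1).

(** State inside a run of the pattern: [j] of its letters remain, the current run of the word has
    [n] letters left, and [R] runs follow. Before the next pattern run starts, [e] further runs of
    the same letter are available. *)
Definition sum_split (j n : nat) (ls : seq nat) (R : nat) : nat :=
  \sum_(0 <= e < R./2.+1)
    'C(n + e * M, j) * sum_from_first run_choices ls (R - e.*2).

(** Reading one letter of the current run is Pascal's rule in [n]; at [n = 0] the next run has the
    wrong letter and is skipped. The condition on [head 0 ls] makes the next pattern run, if any,
    start with [~~ a]. *)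
Lemma run_split_bound ls R a j n ms :
  (forall ms, all (fun m => m <= M) ms ->
     count_occ (alt_word (~~ a) ls) (alt_word (~~ a) ms)
       <= sum_from_any run_choices ls (size ms)) ->
  (ls == [::]) || (head 0 ls != 0) ->
  size ms = R -> all (fun m => m <= M) ms ->
  count_occ (nseq j a ++ alt_word (~~ a) ls) (nseq n a ++ alt_word (~~ a) ms)
    <= sum_split j n ls R.
Proof.
move=> bnd ls0 <-.
have j0 k ms1 : all (fun m => m <= M) ms1 ->
    count_occ (alt_word (~~ a) ls) (nseq k a ++ alt_word (~~ a) ms1)
    <= sum_split 0 k ls (size ms1).
  move=> msM; have -> : sum_split 0 k ls (size ms1) =
      sum_from_any run_choices ls (size ms1).
    by apply: eq_bigr => e _; rewrite bin0 mul1n.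
  apply: leq_trans (bnd _ msM); case: (ls) ls0 => [|[|l] ls1] // _.
    by rewrite !count_occ_nil.
  by rewrite count_occ_nseq_neq //; case: (a).
have [k] := ubnP (size ms); elim: k => // k IH in j n ms *.
rewrite ltnS => msk msM; elim: n j => [|n IHn] [|j]; try exact: j0.
  case: ms msk msM => [|m [|m' ms]] /= msk; rewrite ?andbT.
  - by rewrite /sum_split.
  - by rewrite cats0 -[nseq m _]cats0 count_occ_nseq_neq //; case: (a).
  move=> /and3P[mM m'M msM]; rewrite count_occ_nseq_neq ?negbK; last by case: (a).
  have := IH j.+1 m' ms (leq_trans (leqnSn _) msk) msM; rewrite /=.
  (* On the right the term [e = 0] vanishes, as no [a] is left; the others match after a shift by
     one, using [m' <= M]. *)
  move/leq_trans; apply; rewrite /sum_split /= [leqRHS]big_nat_recl //.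
  rewrite mul0n addn0 bin0n add0n; apply: leq_sum => e _.
  by rewrite doubleS !subSS leq_mul2r leq_bin2l ?orbT // mulSn add0n leq_add2r.
have := leq_add (IHn j) (IHn j.+1); rewrite /= eqxx mul1n => /leq_trans; apply.
by rewrite /sum_split -big_split /=; apply: leq_sum => e _; rewrite addSn binS mulnDl addnC.
Qed.

(** Induction on the pattern runs; an inner induction peels off two runs of the word and separates
    the occurrences whose first letter lies in the leading run, which [step] bounds. *)
Lemma count_occ_alt_word_le a ls ms :
  all (fun l => 0 < l) ls -> all (fun m => m <= M) ms ->
  count_occ (alt_word a ls) (alt_word a ms) <= sum_from_any run_choices ls (size ms).
Proof.
elim: ls a ms => [|l ls IH] a ms /=; first by rewrite sum_from_any_nil count_occ_nil.
case/andP; case: l => // l _ ls0.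
have step m ms1 : m <= M -> all (fun m => m <= M) ms1 ->
    m * count_occ (nseq l a ++ alt_word (~~ a) ls) (nseq m.-1 a ++ alt_word (~~ a) ms1)
    <= sum_from_first run_choices (l.+1 :: ls) (size ms1).+1.
  move=> mM ms1M; apply: (@leq_trans (M * sum_split l M.-1 ls (size ms1))); last first.
    rewrite /= /sum_split big_distrr /=; apply: leq_sum => e _.
    by rewrite /run_choices mulnA.
  have mM' : m.-1 <= M.-1 by rewrite -!subn1 leq_sub2r.
  rewrite leq_mul //; apply: leq_trans (count_occ_nseq_le _ _ _ mM') _.
  apply: run_split_bound => //; first by move=> *; exact: IH.
  by case: (ls) ls0 => //= k ks /andP[]; case: k.
have [k] := ubnP (size ms); elim: k => // k IHk in ms *.
case: ms => [|m [|m' ms]] //= msk; rewrite ?andbT.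
  move=> mM; apply: leq_trans (count_occ_split_run _ _ _ _) _.
  by rewrite addn0 /sum_from_any big_nat1; exact: (step m [::]).
case/and3P=> mM m'M msM; apply: leq_trans (count_occ_split_run _ _ _ _) _.
rewrite sum_from_anySS leq_add //; first by apply: (step m (m' :: ms)); rewrite //= m'M.
rewrite count_occ_nseq_neq ?negbK; last by case: (a).
by apply: IHk => //; apply: leq_trans (leqnSn _) msk.
Qed.
End RunChoices.

(** * Products of weights and the balanced product *)

(** The factor [c] carries the weights of the gaps already chosen, so that [Y] is compared with
    complete products only. *)
Lemma sum_from_first_le g ls R c Y :
  (forall es, size es = size ls -> (sumn es).*2 + size ls <= R ->
     c * \prod_(x <- zip ls es) g x.1 x.2 <= Y) ->
  c * sum_from_first g ls R <= sum_from_first (fun _ _ => 1) ls R * Y.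
Proof.
elim: ls R c => [|l ls IH] R c bnd /=.
  case: leqP => _; rewrite ?muln0 // mul1n muln1.
  by have := bnd [::] erefl (leq0n _); rewrite big_nil muln1.
case: R bnd => [|R] bnd; first by rewrite muln0.
rewrite big_distrr big_distrl /= big_seq [leqRHS]big_seq; apply: leq_sum => e.
rewrite mem_index_iota => /= eR; rewrite mulnA mul1n; apply: IH => es ses sum_es.
have := bnd (e :: es); rewrite /= ses big_cons /= mulnA; apply=> //.
by move: eR sum_es; rewrite ltnS doubleD; lia.
Qed.

Lemma sum_from_any_le g ls R Y :
  (forall es, size es = size ls -> (sumn es).*2 + size ls <= R ->
     \prod_(x <- zip ls es) g x.1 x.2 <= Y) ->
  sum_from_any g ls R <= 'C((R + size ls)./2, size ls) * Y.
Proof.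
move=> bnd; rewrite -sum_from_any1 /sum_from_any big_distrl /=.
apply: leq_sum => e _; rewrite -[leqLHS]mul1n; apply: sum_from_first_le => es ses sum_es.
by rewrite mul1n; apply: bnd => //; apply: leq_trans sum_es (leq_subr _ _).
Qed.

(** The coefficient is the product of [(n + i) / i] for [i] from 1 to [m], each factor being at most
    [n + 1]. *)
Lemma bin_le_expn n m : 'C(n + m, m) <= n.+1 ^ m.
Proof.
elim: m => [|m IH]; first by rewrite bin0.
rewrite -(leq_pmul2l (ltn0Sn m)) addnS -mul_bin_diag expnS mulnA leq_mul //.
by rewrite mulnS mulSn; lia.
Qed.

(** Apply [bin_le_expn] with [m = l - 1]; replacing [l] by [lo] in the base and by [hi] in the
    exponent only enlarges the power, whose base is at least 1. *)
Lemma run_choices_le M l e lo hi :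
  0 < l -> lo <= l <= hi -> l <= M * e.+1 ->
  run_choices M l e <= M * (M * e.+1 - lo).+1 ^ hi.-1.
Proof.
move=> l0 /andP[lol lhi] lM; rewrite /run_choices leq_mul2l; apply/orP; right.
have -> : M.-1 + e * M = (M * e.+1 - l) + l.-1.
  by move: lM; rewrite mulnS (mulnC e); case: (M) => [|m] /=; lia.
apply: leq_trans (bin_le_expn _ _) _.
apply: (@leq_trans ((M * e.+1 - lo).+1 ^ l.-1)); last by rewrite leq_pexp2l //; lia.
have : (M * e.+1 - l < (M * e.+1 - lo).+1)%N by rewrite ltnS leq_sub2l.
by case: l.-1 => [|k] hx; rewrite ?expn0 ?leq_exp2r.
Qed.

Local Open Scope ring_scope.

Section AffineProduct.
Variables (F : realFieldType) (A M : F).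
Hypothesis M_ge0 : 0 <= M.
Let h (e : nat) : F := A + M * e%:R.

(* By Bernoulli's inequality on either side of [q], [h e * (h q / h q.+1) ^ e] is largest
   at [e = q]. *)
Lemma affine_le_geometric (q e : nat) : 0 < h q ->
  h e * (h q ^+ e * h q.+1 ^+ q) <= h q * (h q.+1 ^+ e * h q ^+ q).
Proof.
set a := h q; set b := h q.+1 => a0.
have bE : b = a + M by rewrite /b /a /h -natr1; ring.
have b0 : 0 < b by rewrite bE ltr_wpDr.
have Mt t : 0 <= M * M * t%:R by rewrite !mulr_ge0.
(* Without denominators, [up] is [1 + t * M / a <= (b / a) ^+ t], for [e = q + t], and [dn] is
   [1 - t * M / a <= (a / b) ^+ t], for [e = q - t]. *)
have up t : (a + M * t%:R) * a ^+ t <= a * b ^+ t.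
  elim: t => [|t IH]; first by rewrite mulr0 addr0 !expr0.
  have step : (a + M * t.+1%:R) * a <= (a + M * t%:R) * b.
    by rewrite bE -natr1; have := Mt t; lra.
  rewrite exprS mulrA; apply: le_trans (ler_wpM2r _ step) _; first by rewrite exprn_ge0 ?ltW.
  by rewrite mulrAC exprSr mulrA ler_wpM2r // ltW.
have dn t : (a - M * t%:R) * b ^+ t <= a * a ^+ t.
  elim: t => [|t IH]; first by rewrite mulr0 subr0 !expr0.
  have step : (a - M * t.+1%:R) * b <= (a - M * t%:R) * a.
    by rewrite bE -natr1; have := Mt t; have := Mt 1; lra.
  rewrite exprS mulrA; apply: le_trans (ler_wpM2r _ step) _; first by rewrite exprn_ge0 ?ltW.
  by rewrite mulrAC exprSr mulrA ler_wpM2r // ltW.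
have [/subnKC <-|/ltnW/subnKC eq] := leqP q e.
  set t := (e - q)%N; have -> : h (q + t) = a + M * t%:R by rewrite /a /h natrD; ring.
  have := ler_wpM2r (mulr_ge0 (exprn_ge0 q (ltW a0)) (exprn_ge0 q (ltW b0))) (up t).
  by rewrite !exprD; congr (_ <= _); ring.
move: (q - e)%N eq => t eq; have -> : h e = a - M * t%:R.
  rewrite /a -eq /h natrD; ring.
have := ler_wpM2r (mulr_ge0 (exprn_ge0 e (ltW a0)) (exprn_ge0 e (ltW b0))) (dn t).
have pow_q (x : F) : x ^+ q = x ^+ e * x ^+ t by rewrite -exprD eq.
by rewrite !pow_q; congr (_ <= _); ring.
Qed.

(** With [n = size es], multiplying [affine_le_geometric] over [es] bounds the product by [h q ^+ n]
    times the ratio [h q.+1 / h q] to the power [sumn es - q * n]. The ratio is at least 1, so this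
    exponent may be raised to [k]. *)
Lemma affine_prod_le (es : seq nat) (q k : nat) :
  0 < h q -> all (fun e => 0 <= h e) es ->
  (sumn es <= q * size es + k)%N -> (k <= size es)%N ->
  \prod_(e <- es) h e <= h q ^+ (size es - k) * h q.+1 ^+ k.
Proof.
move=> hq0 es0 sum_es k_le.
have hq_le : h q <= h q.+1 by rewrite /h -natr1 mulrDr mulr1 addrA lerDl.
have hq10 := lt_le_trans hq0 hq_le.
have prod_le : \prod_(e <- es) h e * (h q ^+ sumn es * h q.+1 ^+ (q * size es))
    <= h q ^+ size es * (h q.+1 ^+ sumn es * h q ^+ (q * size es)).
  elim: es es0 {sum_es k_le} => [_|e es IH /= /andP[he es0]].
    by rewrite big_nil !muln0 !expr0.
  rewrite big_cons /=; have {}IH := IH es0.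
  have prod_ge0 : 0 <= \prod_(e <- es) h e.
    by rewrite big_seq prodr_ge0 // => x /(allP es0).
  have := ler_pM _ _ (affine_le_geometric e hq0) IH.
  rewrite mulnS !exprD exprS !mulr_ge0 ?exprn_ge0 ?(ltW hq0) ?(ltW hq10) // => /(_ isT isT).
  by congr (_ <= _); ring.
have pos x y : 0 < h q ^+ x * h q.+1 ^+ y by rewrite mulr_gt0 ?exprn_gt0.
rewrite -(ler_pM2r (pos (sumn es) (q * size es)%N)); apply: le_trans prod_le _.
set n := size es in k_le sum_es *; set s := sumn es in sum_es *.
have : h q ^+ (q * n + k - s) <= h q.+1 ^+ (q * n + k - s).
  by rewrite lerXn2r // nnegrE ltW.
move: (n - k)%N (subnK k_le) => j jk; move: (_ - s)%N (subnK sum_es) => d ds.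
move=> /(ler_wpM2r (ltW (pos (j + s)%N s))).
have pow_n x : x ^+ n = x ^+ j * x ^+ k :> F by rewrite -exprD jk.
have pow_qn x : x ^+ k * x ^+ (q * n) = x ^+ d * x ^+ s :> F by rewrite -!exprD ds addnC.
have -> : h q ^+ n * (h q.+1 ^+ s * h q ^+ (q * n))
  = h q ^+ j * h q.+1 ^+ s * (h q ^+ k * h q ^+ (q * n)) by rewrite pow_n; ring.
have -> : h q ^+ j * h q.+1 ^+ k * (h q ^+ s * h q.+1 ^+ (q * n))
  = h q ^+ j * h q ^+ s * (h q.+1 ^+ k * h q.+1 ^+ (q * n)) by ring.
by rewrite !pow_qn exprD; congr (_ <= _); ring.
Qed.
End AffineProduct.

(** * The rounded quantities of the bound as natural numbers *)

Lemma floor_half_diff (r R : nat) :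
  Num.floor ((R%:R - r%:R) / 2 : rat) + r%:Z = ((R + r)./2)%:Z.
Proof.
have Rr : (R + r = odd (R + r) + (R + r)./2.*2)%N by rewrite odd_double_half.
move: (_ ./2)%N (odd _) Rr => h b Rr.
rewrite (@Num.Theory.floor_def _ _ (h%:Z - r%:Z)) ?subrK //.
rewrite !rmorphD rmorphN /= -!pmulrn.
have {Rr} : R%:R + r%:R = b%:R + h%:R * 2 :> rat by rewrite -natrM -!natrD Rr muln2.
by case: b => /= Rr; apply/andP; split; lra.
Qed.

(** Write [R = r + b + 2 * E] with [b <= 1] and [E = q * r + k]. Then [R / r] exceeds [2 * q + 1] by
    [(b + 2 * k) / r < 2], and [R - r * (2 * q + 1) = b + 2 * k] has even part [2 * k]. *)
Lemma sigmaE (r R i : nat) : (0 < r <= R)%N ->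
  sigma r R i =
  ((((R - r)./2 %/ r + (i <= (R - r)./2 %% r)%N) * 2).+1)%:Z.
Proof.
move=> /andP[r0 rR]; set E := (R - r)./2; set q := (E %/ r)%N; set k := (E %% r)%N.
have Eqk : E = (q * r + k)%N by exact: divn_eq.
have kr : (k < r)%N by rewrite ltn_mod.
have [b [b1 RE]] : exists b : nat, (b <= 1)%N /\ R = (r + b + E * 2)%N.
  by exists (odd (R - r)); split; [case: odd|rewrite muln2 -addnA odd_double_half subnKC].
have r0' : 0 < r%:R :> rat by rewrite ltr0n.
have oE : largest_odd_le (R%:R / r%:R : rat) = (q * 2).+1%:Z.
  rewrite /largest_odd_le (@Num.Theory.floor_def _ _ q%:Z); first by lia.
  rewrite rmorphD rmorph1 /= -!pmulrn; apply/andP; split.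
    rewrite ler_pdivlMr ?ltr0n // lerBrDr ler_pdivlMr // -natrM natr1 -natrM ler_nat RE Eqk.
    by nia.
  rewrite natr1 ltr_pdivrMr ?ltr0n // ltrBlDr ltr_pdivrMr // -natrM natr1 -natrM ltr_nat RE Eqk.
  by nia.
rewrite /sigma oE.
have -> : largest_even_le (R%:R - r%:R * ((q * 2).+1%:Z)%:~R : rat) = (k * 2)%:Z.
  rewrite /largest_even_le (@Num.Theory.floor_def _ _ k%:Z); first by lia.
  rewrite rmorphD rmorph1 /= -!pmulrn natr1; apply/andP; split.
    rewrite ler_pdivlMr // lerBrDr -!natrM -natrD ler_nat RE Eqk; nia.
  rewrite ltr_pdivrMr // ltrBlDr -!natrM -natrD ltr_nat RE Eqk; nia.
rewrite -!pmulrn natrM [2^-1 * _]mulrC mulfK // ler_nat.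
by case: (i <= k)%N; lia.
Qed.

Lemma min_run_le_size (w u : word) : u \in runs w -> (min_run w <= size u)%N.
Proof.
rewrite /min_run; elim: (runs w) => // v rs IH.
by rewrite inE big_cons geq_min => /orP[/eqP->|/IH ->]; rewrite ?leqnn ?orbT.
Qed.

Lemma has_le_average (es : seq nat) (q : nat) :
  (sumn es < q.+1 * size es)%N -> has (fun e => e <= q)%N es.
Proof.
elim: es => [|e es IH] /=; first by lia.
by rewrite mulnS; case: (leqP e q) => //= ? ?; apply: IH; lia.
Qed.

Lemma prod_balanced (F : comPzRingType) (h : nat -> F) (q k r : nat) : (k <= r)%N ->
  \prod_(1 <= i < r.+1) h (q + (i <= k))%N = h q ^+ (r - k) * h q.+1 ^+ k.
Proof.
move=> kr; rewrite (@big_cat_nat _ _ _ k.+1) //= mulrC; congr (_ * _).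
  rewrite (eq_big_nat _ _ (F2 := fun=> h q)) ?prodr_const_nat ?subSS // => i.
  by case/andP => ki _; rewrite leqNgt ki addn0.
rewrite (eq_big_nat _ _ (F2 := fun=> h q.+1)) ?prodr_const_nat ?subn1 // => i.
by case/andP => _ ik; rewrite -ltnS ik addn1.
Qed.

(** Either some pattern run does not fit into its available letters and the left side is 0, or all
    affine factors are nonnegative and the balanced product dominates. The maximum with 0 serves the
    first case. *)
Lemma prod_run_choices_le (M lo hi R : nat) (ls es : seq nat) :
  ls != [::] -> all (fun l => (0 < l) && (lo <= l <= hi))%N ls ->
  size es = size ls -> ((sumn es).*2 + size ls <= R)%N ->
  (\prod_(x <- zip ls es) run_choices M x.1 x.2)%:R <=
  Num.max 0 (\prod_(1 <= i < (size ls).+1)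
    (M%:R * (M%:R / 2 * ((sigma (size ls) R i)%:~R + 1) - lo%:R + 1) ^+ (hi - 1)) : rat).
Proof.
move=> lsN ls_b ses sum_es; set r := size ls in ses sum_es *.
have r0 : (0 < r)%N by rewrite /r; case: (ls) lsN.
have rR : (r <= R)%N by lia.
have [fits|] := boolP (all (fun x => x.1 <= M * x.2.+1)%N (zip ls es)); last first.
  case/allPn => x xz; rewrite -ltnNge => Mx.
  suff rc0 : run_choices M x.1 x.2 = 0%N by rewrite (big_rem x) //= rc0 mul0n le_max lexx.
  rewrite /run_choices; case: (M) Mx => [|m] Mx; first by rewrite mul0n.
  rewrite bin_small ?muln0 //=; move: (x.1) (x.2) Mx => l e.
  by rewrite mulnS (mulnC e); move: (_ * e)%N => y; lia.
set E := ((R - r)./2)%N; set q := (E %/ r)%N; set k := (E %% r)%N.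
have Eqk : E = (q * r + k)%N by exact: divn_eq.
have kr : (k < r)%N by rewrite ltn_mod.
have sumE : (sumn es <= q * r + k)%N by rewrite -Eqk /E; lia.
(* [h e] is the base of the power in the bound when [sigma] equals [2 * e + 1]. *)
pose A : rat := M%:R - lo%:R + 1.
pose h (e : nat) : rat := A + M%:R * e%:R.
have hE e : (lo <= M * e.+1)%N -> h e = (M * e.+1 - lo).+1%:R.
  by move=> lo_e; rewrite /h /A -natr1 natrB // natrM -natr1; ring.
have lo_es : all (fun e => lo <= M * e.+1)%N es.
  apply/allP => e; rewrite -[es](@unzip2_zip _ _ ls) ?ses // => /mapP[x xz ->].
  apply: leq_trans (allP fits _ xz).
  move: xz => /(map_f fst); rewrite -/unzip1 unzip1_zip ?ses //.
  by move=> /(allP ls_b) /and3P[].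
have hq0 : 0 < h q.
  (* Since [k < r], some entry is at most [q]; its run fits, which makes [h q] positive. *)
  have /hasP[e ees eq] : has (fun e => e <= q)%N es.
    by apply: has_le_average; rewrite ses mulSn; lia.
  rewrite hE ?ltr0n //; apply: leq_trans (allP lo_es _ ees) _.
  by rewrite leq_mul2l ltnS eq orbT.
have es_h : all (fun e => 0 <= h e) es.
  by apply: sub_all lo_es => e lo_e; rewrite hE.
have := affine_prod_le (ler0n _ M) hq0 es_h; rewrite ses => /(_ k sumE (ltnW kr)).
rewrite -(prod_balanced h q (ltnW kr)) => prod_le.
rewrite le_max; apply/orP; right.
have -> : \prod_(1 <= i < r.+1) (M%:R *
    (M%:R / 2 * ((sigma r R i)%:~R + 1) - lo%:R + 1) ^+ (hi - 1)) =
    M%:R ^+ r * (\prod_(1 <= i < r.+1) h (q + (i <= k)%N)%N) ^+ hi.-1 :> rat.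
  rewrite -prodrXl big_split prodr_const_nat subSS subn0 subn1; congr (_ * _).
  apply: eq_bigr => i _; rewrite sigmaE ?r0 // -/E -/q -/k -pmulrn.
  move: (q + _)%N => s; have -> : (s * 2).+1%:R = s%:R * 2 + 1 :> rat by rewrite -natr1 natrM.
  by congr (_ ^+ _); rewrite /h /A; field.
apply: (@le_trans _ _ (M%:R ^+ r * (\prod_(e <- es) h e) ^+ hi.-1)); last first.
  have prod_ge0 : 0 <= \prod_(e <- es) h e.
    by rewrite big_seq prodr_ge0 // => e /(allP es_h).
  by rewrite ler_wpM2l ?exprn_ge0 // lerXn2r // nnegrE (le_trans prod_ge0).
have -> : M%:R ^+ r * (\prod_(e <- es) h e) ^+ hi.-1 =
    (\prod_(x <- zip ls es) (M * (M * x.2.+1 - lo).+1 ^ hi.-1))%N%:R.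
  rewrite -(big_map snd xpredT (fun e => M * (M * e.+1 - lo).+1 ^ hi.-1)%N).
  rewrite -/unzip2 unzip2_zip ?ses // big_split /= natrM; congr (_ * _).
    by rewrite natr_prod big_const_seq count_predT ses iter_mulr_1.
  rewrite -prodrXl natr_prod big_seq [RHS]big_seq; apply: eq_bigr => e ees.
  by rewrite natrX hE // (allP lo_es).
rewrite ler_nat big_seq [leqRHS]big_seq; apply: leq_prod => x xz.
move: (xz) => /(map_f fst); rewrite -/unzip1 unzip1_zip ?ses //.
by move=> /(allP ls_b) /andP[x0 xb]; apply: run_choices_le => //; exact: (allP fits).
Qed.

(** * The equality case and the final assembly *)

(** Pascal's rule: the first letter of the word is either used, or skipped together with the next
    one, which is the wrong letter. *)
Lemma count_occ_alternating (a : bool) (r R : nat) :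
  count_occ (alt_word a (nseq r 1)) (alt_word a (nseq R 1)) = 'C((R + r)./2, r).
Proof.
suff: count_occ (alt_word a (nseq r 1)) (alt_word a (nseq R 1)) = 'C((R + r)./2, r) /\
  count_occ (alt_word a (nseq r 1)) (alt_word a (nseq R.+1 1)) = 'C((R.+1 + r)./2, r) by case.
elim: R a r => [|R IH] a [|r].
- by rewrite !count_occ_nil !bin0.
- rewrite /= eqxx; case: r => [|r] /=; first by [].
  by rewrite !bin_small // ?uphalf_half; lia.
- by rewrite !count_occ_nil !bin0.
split; first by have [] := IH a r.+1.
have [_ IH1] := IH (~~ a) r; have [IH2 _] := IH a r.+1.
have -> : count_occ (alt_word a (nseq r.+1 1)) (alt_word a (nseq R.+2 1)) =
    (count_occ (alt_word (~~ a) (nseq r 1)) (alt_word (~~ a) (nseq R.+1 1))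
     + count_occ (alt_word a (nseq r.+1 1)) (nseq 1 (~~ a) ++ alt_word (~~ ~~ a) (nseq R 1)))%N.
  by rewrite [LHS]/= eqxx mul1n.
rewrite count_occ_nseq_neq ?negbK; last by case: (a).
by rewrite IH1 IH2 !addSn !addnS /= binS addnC.
Qed.

Lemma alternating_max_run (w : word) : alternating w -> w != [::] -> max_run w = 1%N.
Proof.
case: w => // a w alt_w _; have [v [rs E]] := runs_cons a w.
rewrite /max_run -(big_map size xpredT id) alternating_map_size // /nruns E /=.
by elim: rs {E} => [|u rs IH]; rewrite /= big_cons ?big_nil // IH.
Qed.

(* The maximum with 0 matters only when B < 0, as for p = 0000 and w = 0, where
   occ p w = 0 and B = -8. *)
Theorem theorem1p8 (p w : word) (p_neq_nil : p != [::]) :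
  let r := nruns p in
  let rmin := min_run p in
  let rmax := max_run p in
  let w' := remove_nbr p w in
  let R' := nruns w' in
  let R'max := max_run w' in
  let B : rat :=
    'C(`|(Num.floor ((R'%:R - r%:R) / 2 : rat) + r%:Z)%R|%N, r)%:R *
    \prod_(1 <= i < r.+1)
      (R'max%:R *
       (R'max%:R / 2 * ((sigma r R' i)%:~R + 1) - rmin%:R + 1) ^+ (rmax - 1)) in
  (occ p w)%:R <= Num.max 0 B /\
  (alternating p -> alternating w -> (occ p w)%:R = B).
Proof.
move=> r rmin rmax w' R' R'max B.
pose ls := map size (runs p); pose ms := map size (runs w').
have size_ls : size ls = r by rewrite size_map.
have size_ms : size ms = R' by rewrite size_map.
have r0 : (0 < r)%N.
  by rewrite /r /nruns; case: (p) p_neq_nil => // a q _; have [v [rs ->]] := runs_cons a q.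
have [_ [_ [_ w'_head]]] := remove_nbr_cat p w.
have pE : alt_word (head false p) ls = p by exact: alt_word_runs.
have w'E : alt_word (head false p) ms = w' by exact: alt_word_runs_head.
have occE : occ p w = count_occ (alt_word (head false p) ls) (alt_word (head false p) ms).
  by rewrite occ_count_occ -count_occ_remove_nbr // pE w'E.
have topE : `|(Num.floor ((R'%:R - r%:R) / 2 : rat) + r%:Z)%R|%N = (R' + r)./2.
  by rewrite floor_half_diff.
rewrite {}/B {}topE {}occE; split; last first.
  move=> alt_p alt_w; have alt_w' : alternating w' by exact: alternating_remove_nbr.
  have -> : ls = nseq r 1%N by exact: alternating_map_size.
  have -> : ms = nseq R' 1%N by exact: alternating_map_size.
  rewrite count_occ_alternating (eq_bigr (fun=> R'max%:R)); last first.
    by move=> i _; rewrite [rmax]alternating_max_run // subnn expr0 mulr1.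
  (* For empty [w'] the maximum run is 0 rather than 1, but the binomial coefficient already
     vanishes because [r] is positive. *)
  have [w'0|w'N] := eqVneq w' [::]; last first.
    by rewrite [R'max]alternating_max_run // big1_eq mulr1.
  have -> : R' = 0%N by rewrite /R' w'0.
  by rewrite add0n bin_small ?mul0r //; lia.
set X := \prod_(1 <= i < r.+1) _.
have X0 : 0 <= Num.max 0 X by rewrite le_max lexx.
apply: (@le_trans _ _ ('C((R' + r)./2, r)%:R * Num.max 0 X)); last first.
  by rewrite maxr_pMr ?mulr0 ?ler0n.
(* [sum_from_any_le] takes a natural [Y]; truncating is harmless since products of weights are
   natural numbers. *)
apply: (@le_trans _ _ ('C((R' + r)./2, r)%:R * (Num.truncn (Num.max 0 X))%:R)); last first.
  by rewrite ler_wpM2l // truncn_le.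
rewrite -natrM ler_nat -[in leqRHS]size_ls.
apply: leq_trans (@count_occ_alt_word_le R'max _ _ _ _ _) _.
- apply/allP => _ /mapP[u up ->]; rewrite lt0n size_eq0; exact: runs_neq_nil up.
- by apply/allP => _ /mapP[u uw ->]; exact: size_le_max_run.
rewrite size_ms; apply: sum_from_any_le => es ses sum_es.
rewrite truncn_ge_nat // /X -size_ls.
apply: prod_run_choices_le => //; first by rewrite -size_eq0 size_ls -lt0n.
apply/allP => _ /mapP[u up ->]; rewrite lt0n size_eq0 (runs_neq_nil up).
by rewrite min_run_le_size // size_le_max_run.
Qed.
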